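(* Let $n$ be a positive integer relatively prime to $10$. Then $n$ is a Lucas probable prime for Method A if and only if $n$ is a Lucas probable prime for Method A*.
   Context: For integers $P > 0$ and $Q$ with $D = P^2 - 4Q \ne 0$, the Lucas sequences $U_j(P,Q)$, $V_j(P,Q)$ are defined by $U_0 = 0$, $U_1 = 1$, $V_0 = 2$, $V_1 = P$, and $U_j = PU_{j-1} - QU_{j-2}$, $V_j = PV_{j-1} - QV_{j-2}$ for $j \ge 2$. Method A: let $D$ be the first element of the sequence $5, -7, 9, -11, 13, -15, \ldots$ (i.e. $(-1)^{j}(2j+5)$ for $j = 0,1,2,\dots$) for which the Jacobi symbol $(D/n) = -1$, and set $P = 1$, $Q = (1-D)/4$. Method A*: choose $D, P, Q$ as in Method A, but if $Q = -1$ (i.e. $D = 5$), replace $P$ and $Q$ both by $5$ (so $D$ is unchanged). We say $n$ is a Lucas probable prime for a method if the method produces parameters $P, Q$ (i.e. some $D$ in the sequence has $(D/n) = -1$) and $U_{n+1}(P,Q) \equiv 0 \pmod n$. *)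

(* Defs.v *)
From mathcomp Require Import all_boot all_order all_algebra.

Set Implicit Arguments.
Unset Strict Implicit.
Unset Printing Implicit Defensive.

Import GRing.Theory.
Local Open Scope ring_scope.

(* Meaningful for p an odd prime. *)
Definition legendre (a : int) (p : nat) : int :=
  if (p%:Z %| a)%Z then 0
  else if [exists x : 'I_p, ((nat_of_ord x)%:Z ^+ 2 == a %[mod p%:Z])%Z] then 1
  else -1.

(* Meaningful for n odd and positive; the empty product gives (a/1) = 1. *)
Definition jacobi (a : int) (n : nat) : int :=
  \prod_(p <- primes n) legendre a p ^+ logn p n.

Fixpoint lucasU (P Q : int) (j : nat) : int :=
  match j with
  | 0%N => 0
  | 1%N => 1
  | (j'.+1 as j1).+1 => P * lucasU P Q j1 - Q * lucasU P Q j'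
  end.

Definition Dseq (j : nat) : int := (-1) ^+ j * (2 * j + 5)%N%:Z.

Definition first_D (n : nat) (D : int) : Prop :=
  exists j : nat,
    [/\ D = Dseq j, jacobi D n = -1 &
        forall i : nat, (i < j)%N -> jacobi (Dseq i) n <> -1].

(* A method is the relation "on input n, the parameters P, Q are produced";
   it relates n to no (P, Q) when the search for D never succeeds. *)
Definition method := nat -> int -> int -> Prop.

(* Every term of Dseq is 1 modulo 4, so the integer division is exact. *)
Definition methodA : method := fun n P Q =>
  exists D : int, [/\ first_D n D, P = 1 & Q = ((1 - D) %/ 4)%Z].

Definition methodAstar : method := fun n P Q =>
  exists P0 Q0 : int,
    methodA n P0 Q0 /\ (P, Q) = if Q0 == -1 then (5, 5) else (P0, Q0).

Definition lucas_prp (M : method) (n : nat) : Prop :=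
  exists P Q : int, M n P Q /\ (lucasU P Q n.+1 = 0 %[mod n%:Z])%Z.

(* Main.v *)
(** If a and b are the roots of x^2 - x - 1, those of x^2 - 5x + 5 are sqrt(5) a
    and - sqrt(5) b, so that U_{2m}(5, 5) = 5^m U_{2m}(1, -1). As n is odd, this
    applies to the index n + 1, and the factor 5^m is invertible modulo n. *)
Require Import Defs.
From mathcomp Require Import all_boot all_order all_algebra.
From mathcomp Require Import ring.

Import GRing.Theory.

Lemma lucasUSS (P Q : int) (j : nat) :
  (lucasU P Q j.+2 = P * lucasU P Q j.+1 - Q * lucasU P Q j)%R.
Proof. by []. Qed.

(* The odd-index values 5^m (a^(2m+1) + b^(2m+1)) make the induction go through. *)
Lemma lucasU55_pair (m : nat) :
  (lucasU 5 5 m.*2 = 5 ^+ m * lucasU 1 (-1) m.*2 /\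
   lucasU 5 5 m.*2.+1 =
     5 ^+ m * (2 * lucasU 1 (-1) m.*2 + lucasU 1 (-1) m.*2.+1))%R.
Proof.
elim: m => [//|m [IHeven IHodd]].
(* Proved before splitting: the recurrence at the odd index 2m + 3 also uses this even value. *)
have IHeven' : (lucasU 5 5 m.*2.+2 = 5 ^+ m.+1 * lucasU 1 (-1) m.*2.+2)%R.
  by rewrite !lucasUSS IHodd IHeven exprS; ring.
split; rewrite doubleS // lucasUSS IHeven' IHodd !lucasUSS exprS; ring.
Qed.

Lemma lucasU55_double (m : nat) :
  (lucasU 5 5 m.*2 = 5 ^+ m * lucasU 1 (-1) m.*2)%R.
Proof. by case: (lucasU55_pair m). Qed.

Lemma eq0_mod_lucasU55 (n : nat) : coprime n 10 ->
  (lucasU 5 5 n.+1 = 0 %[mod n%:Z])%Z <->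
  (lucasU 1 (-1) n.+1 = 0 %[mod n%:Z])%Z.
Proof.
(* The literal [10] matches [2 * 5] by computation. *)
rewrite (coprimeMr n 2 5) => /andP[co_n2 co_n5].
have even_n1 : n.+1./2.*2 = n.+1.
  by rewrite even_halfK //= negbK -coprimen2.
have co_n5X : coprimez n (5 ^+ n.+1./2)%R by rewrite coprimezXr.
rewrite -{1 2}even_n1 lucasU55_double even_n1 mod0z.
split=> /dvdz_mod0P dvd_n; apply/dvdz_mod0P; last by rewrite Gauss_dvdzr.
by rewrite -(Gauss_dvdzr _ co_n5X).
Qed.

Theorem theorem3 (n : nat) (n_gt0 : (0 < n)%N) (n_cop10 : coprime n 10) :
  lucas_prp methodA n <-> lucas_prp methodAstar n.
Proof.
split=> [[P [Q [AnPQ U0]]] | [P [Q [[P0 [Q0 [AnPQ def_PQ]]] U0]]]].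
  (* The two methods choose different parameters only when [Q] is -1. *)
  have [Q_N1|Q_neqN1] := eqVneq Q (-1)%R; last first.
    by exists P, Q; split=> //; exists P, Q; rewrite (negPf Q_neqN1).
  exists 5%R, 5%R; split; first by exists P, Q; split=> //; rewrite Q_N1.
  by apply/eq0_mod_lucasU55 => //; case: AnPQ U0 => D [_ -> _]; rewrite Q_N1.
exists P0, Q0; split=> //.
case: eqVneq def_PQ => [Q0_N1 | _] [defP defQ]; last by rewrite -defP -defQ.
(* Method A forces [P0 = 1], so the pair replaced by (5, 5) is exactly (1, -1). *)
case: AnPQ => D [_ -> _]; rewrite Q0_N1.
by apply/eq0_mod_lucasU55 => //; rewrite defP defQ in U0.
Qed.
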